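(* Let $r > t \ge 1$ be integers. There exist $\varepsilon_{0}>0$ and $n_{0}(r,t)$ such that the following holds for all real $\varepsilon<\varepsilon_{0}$ and all $n \ge n_{0}(r,t)$. If $G$ is an $n$-vertex $(K_{r},t)$-intersecting graph with $$N(K_{r},G) \ge (1-\varepsilon) \left(\frac{n-t}{r-t}\right)^{r-t},$$ then there exists a $t$-element set $T\subset V(G)$ such that $G-T$ can be made $(r-t)$-partite by removing at most $2\varepsilon (n-t)^2$ edges.
   Context: All graphs are finite and simple. $N(K_r,G)$ denotes the number of copies of $K_r$ in $G$, i.e. the number of $r$-subsets $S$ of $V(G)$ such that the induced subgraph $G[S]$ is isomorphic to the complete graph $K_r$. A graph $G$ is $(K_r,t)$-intersecting if for every two distinct $r$-sets $S,S'\subset V(G)$ with $G[S]\cong G[S']\cong K_r$ one has $|S\cap S'|\in\{t,t+1,\ldots,r-1\}$. $G-T$ denotes the induced subgraph of $G$ on $V(G)\setminus T$. A graph is $k$-partite if its vertex set can be partitioned into $k$ (possibly empty) independent sets. *)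

(* Defs.v *)
From HB Require Import structures.
From mathcomp Require Import all_boot all_order all_algebra.
From mathcomp Require Import boolp reals.

Set Implicit Arguments.
Unset Strict Implicit.
Unset Printing Implicit Defensive.

Record sgraph := SGraph {
  vertex :> finType;
  adj : rel vertex;
  adj_sym : symmetric adj;
  adj_irrefl : irreflexive adj }.

Section Constructions.
Variable G : sgraph.

Section Induced.
Variable S : {set G}.

Definition induced_adj : rel {x : G | x \in S} :=
  fun x y => adj (val x) (val y).

Lemma induced_sym : symmetric induced_adj.
Proof. by move=> x y; rewrite /induced_adj adj_sym. Qed.

Lemma induced_irrefl : irreflexive induced_adj.
Proof. by move=> x; rewrite /induced_adj adj_irrefl. Qed.

Definition induced : sgraph := SGraph induced_sym induced_irrefl.
End Induced.

Definition delete_vertices (T : {set G}) : sgraph := induced (~: T).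

Definition edges : {set {set G}} :=
  [set [set p.1; p.2] | p : G * G & adj p.1 p.2].

Section DeleteEdges.
Variable F : {set {set G}}.

Definition delete_edges_adj : rel G :=
  fun x y => adj x y && ([set x; y] \notin F).

Lemma delete_edges_sym : symmetric delete_edges_adj.
Proof. by move=> x y; rewrite /delete_edges_adj adj_sym setUC. Qed.

Lemma delete_edges_irrefl : irreflexive delete_edges_adj.
Proof. by move=> x; rewrite /delete_edges_adj adj_irrefl. Qed.

Definition delete_edges : sgraph := SGraph delete_edges_sym delete_edges_irrefl.
End DeleteEdges.

End Constructions.

Section Complete.
Variable r : nat.

Definition complete_adj : rel 'I_r := fun i j => i != j.

Lemma complete_sym : symmetric complete_adj.
Proof. by move=> i j; rewrite /complete_adj eq_sym. Qed.

Lemma complete_irrefl : irreflexive complete_adj.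
Proof. by move=> i; rewrite /complete_adj eqxx. Qed.

Definition complete : sgraph := SGraph complete_sym complete_irrefl.
End Complete.

Definition isomorphic (G H : sgraph) : Prop :=
  exists2 f : G -> H, bijective f & forall x y : G, adj (f x) (f y) = adj x y.

Definition copies (r : nat) (G : sgraph) : {set {set G}} :=
  [set S : {set G} | (#|S| == r) && `[< isomorphic (induced S) (complete r) >]].

Definition intersecting (r t : nat) (G : sgraph) : Prop :=
  forall S S' : {set G}, S \in copies r G -> S' \in copies r G -> S != S' ->
    t <= #|S :&: S'| <= r.-1.

Definition independent (G : sgraph) (A : {set G}) : Prop :=
  {in A &, forall x y, ~~ adj x y}.

(* The parts are the fibres of [c]; some of them may be empty. *)
Definition partite (k : nat) (G : sgraph) : Prop :=
  exists c : G -> 'I_k, forall i : 'I_k, independent [set x | c x == i].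

(* Main.v *)
Require Import Defs.
From HB Require Import structures.
From mathcomp Require Import all_boot all_order all_algebra.
From mathcomp Require Import boolp reals.
From mathcomp Require Import zify lra.

Set Implicit Arguments.
Unset Strict Implicit.
Unset Printing Implicit Defensive.

(* Put k = r - t and m = n - t. A t-intersecting family of r-sets whose members
   have no t points in common has only O(n^(k-1)) members, so all copies of K_r
   contain one t-set T. The common neighbourhood A of T is K_(k+1)-free, since
   a K_(k+1) in A could replace a vertex of T, and it contains as many K_k as G
   contains K_r. With a = |A|, the Moon-Moser inequalities
   k s N_s <= (k - s + 1) a N_(s-1) bound the number of edges in A from below by
   binom(k,2) (a/k)^2 times N_k / (a/k)^k, and Füredi's stability argument
   turns this into a k-colouring of A with at most eps a^2 monochromatic pairs.
   The same count gives a >= (1 - eps) m, so at most eps m^2 edges of G - T do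
   not lie inside A. *)

(** * Counting cliques through neighbourhoods *)

Section CliqueCounts.
Variable G : sgraph.
Implicit Types (S A B Q T : {set G}) (v x y : G).

Definition clique S := [forall x in S, forall y in S, (x != y) ==> adj x y].

Definition cliques s A :=
  [set S : {set G} | [&& S \subset A, #|S| == s & clique S]].

Definition nbrs A x := [set y in A | adj x y].

Lemma cliqueP S :
  reflect {in S &, forall x y, x != y -> adj x y} (clique S).
Proof.
apply: (iffP forall_inP) => [cS x y xS yS | cS x xS].
  by move/forall_inP: (cS x xS) => /(_ y yS) /implyP.
by apply/forall_inP => y yS; apply/implyP; apply: cS.
Qed.

Lemma sub_clique S Q : Q \subset S -> clique S -> clique Q.
Proof.
by move=> /subsetP QS /cliqueP cS; apply/cliqueP => x y /QS xS /QS; apply: cS.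
Qed.

Lemma mem_nbrs A x y : (y \in nbrs A x) = (y \in A) && adj x y.
Proof. by rewrite inE. Qed.

Lemma cliqueU1 v Q A : v \in A ->
  Q \subset nbrs A v -> clique Q -> v |: Q \subset A /\ clique (v |: Q).
Proof.
move=> vA /subsetP Qv /cliqueP cQ; split.
  by apply/subsetP => x /setU1P [->//|/Qv]; rewrite mem_nbrs => /andP[].
have adjv x : x \in Q -> adj v x by move/Qv; rewrite mem_nbrs => /andP[].
apply/cliqueP => x y /setU1P [->|xQ] /setU1P [->|yQ].
- by rewrite eqxx.
- by rewrite adjv.
- by rewrite adj_sym adjv.
- exact: cQ.
Qed.

Lemma card_cliques_through s A v : v \in A ->
  #|[set S in cliques s.+1 A | v \in S]| = #|cliques s (nbrs A v)|.
Proof.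
move=> vA.
have vN Q : Q \subset nbrs A v -> v \notin Q.
  by move=> /subsetP Qv; apply/negP => /Qv; rewrite mem_nbrs adj_irrefl andbF.
rewrite -(@card_in_imset _ _ (fun Q => v |: Q) (cliques s (nbrs A v))); last first.
  move=> P Q; rewrite !inE => /and3P[/vN vP _ _] /and3P[/vN vQ _ _] PQ.
  by rewrite -(setU1K vP) PQ setU1K.
apply: eq_card => S; apply/idP/imsetP => [|[Q]].
  rewrite !inE => /andP[/and3P[SA /eqP cS kS] vS].
  exists (S :\ v); last by rewrite setD1K.
  rewrite inE (sub_clique (subD1set _ _) kS) andbT; apply/andP; split.
    apply/subsetP => x /setD1P [xv xS]; rewrite mem_nbrs (subsetP SA) //=.
    by move/cliqueP: kS => ->//; rewrite eq_sym.
  by have := cardsD1 v S; rewrite cS vS => -[->].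
move=> /[!inE] /and3P[Qv /eqP cQ kQ] ->; rewrite setU11 andbT.
have [-> ->] := cliqueU1 vA Qv kQ.
by rewrite cardsU1 vN // cQ eqxx.
Qed.

(** Double counting of the pairs of a vertex and a clique containing it. Weight 1 gives
    [card_cliquesS]; degrees as weights serve in the Moon-Moser induction. *)
Lemma sum_cliques_nbrs (f : G -> nat) s A :
  \sum_(v in A) f v * #|cliques s (nbrs A v)| =
  \sum_(S in cliques s.+1 A) \sum_(v in S) f v.
Proof.
transitivity (\sum_(v in A) \sum_(S in cliques s.+1 A | v \in S) f v).
  apply: eq_bigr => v vA; rewrite -card_cliques_through // mulnC -sum_nat_const.
  by apply: eq_bigl => S; rewrite inE.
rewrite (exchange_big_dep (mem (cliques s.+1 A))) /=; last by move=> v S _ /andP[].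
apply: eq_bigr => S kS; apply: eq_bigl => v; rewrite kS /=.
rewrite andb_idl // => vS; move: kS; rewrite inE => /and3P[/subsetP SA _ _].
exact: SA.
Qed.

Lemma card_cliquesS s A :
  \sum_(v in A) #|cliques s (nbrs A v)| = s.+1 * #|cliques s.+1 A|.
Proof.
have := sum_cliques_nbrs (fun=> 1) s A.
under eq_bigr do rewrite mul1n; move=> ->.
rewrite mulnC -sum_nat_const; apply: eq_bigr => S; rewrite inE.
by case/and3P=> _ /eqP <- _; rewrite sum1_card.
Qed.

Lemma cliques_nbrs0 s A v : v \in A ->
  #|cliques s.+1 A| = 0 -> #|cliques s (nbrs A v)| = 0.
Proof.
by move=> vA kA; have := card_cliquesS s A; rewrite kA muln0 => /eqP;
  rewrite sum_nat_eq0 => /forall_inP /(_ v vA) /eqP.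
Qed.

Lemma card_cliques1 A : #|cliques 1 A| = #|A|.
Proof.
rewrite -(card_imset _ (@set1_inj G)); apply: eq_card => S.
apply/idP/imsetP => [|[x xA ->]]; rewrite inE.
  case/and3P => SA /cards1P [x Sx] _; exists x => //.
  by move: SA; rewrite Sx sub1set.
rewrite sub1set xA cards1 eqxx /=; apply/cliqueP => y z /set1P-> /set1P->.
by rewrite eqxx.
Qed.

Lemma sum_degrees A : \sum_(x in A) #|nbrs A x| = 2 * #|cliques 2 A|.
Proof.
by rewrite -card_cliquesS; apply: eq_bigr => x _; rewrite card_cliques1.
Qed.

(** * Füredi's colouring and Turán's bound *)

(* Ordered pairs: each edge is counted twice. *)
Definition pairs_in (w : rel G) A := \sum_(x in A) \sum_(y in A) w x y.

Lemma pairs_in_setD (w : rel G) A B : symmetric w -> B \subset A ->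
  pairs_in w A = pairs_in w B + 2 * \sum_(x in A :\: B) \sum_(y in B) w x y
                 + pairs_in w (A :\: B).
Proof.
move=> wsym BA; rewrite /pairs_in.
have split_sum (F : G -> nat) :
    \sum_(x in A) F x = \sum_(x in B) F x + \sum_(x in A :\: B) F x.
  by rewrite (big_setID B) /=; move/setIidPr: BA => ->.
rewrite split_sum.
under eq_bigr do rewrite split_sum.
under [X in _ + X = _]eq_bigr do rewrite split_sum.
rewrite !big_split /=.
rewrite [X in _ + X + _ = _]exchange_big /=.
under [X in _ + X + _ = _]eq_bigr do under eq_bigr do rewrite wsym.
lia.
Qed.

Lemma card_nbrs A x : #|nbrs A x| = \sum_(y in A) adj x y.
Proof.
rewrite -sum1_card big_mkcond [RHS]big_mkcond; apply: eq_bigr => y _.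
by rewrite mem_nbrs; case: (y \in A); case: (adj x y).
Qed.

Lemma eq_pairs_in (w w' : rel G) A :
  {in A &, w =2 w'} -> pairs_in w A = pairs_in w' A.
Proof.
by move=> ww; apply: eq_bigr => x xA; apply: eq_bigr => y yA; rewrite ww.
Qed.

(* Füredi's argument: the first class consists of the non-neighbours of a
   vertex [v] of maximum degree, the others come from the neighbourhood of [v],
   which contains no clique of size [k]. *)
Lemma furedi_colouring k A : #|cliques k.+1 A| = 0 ->
  exists c : G -> nat, {in A, forall x, c x < k} /\
    pairs_in (@adj G) A + pairs_in (fun x y => adj x y && (c x == c y)) A
      <= pairs_in (fun x y => c x != c y) A.
Proof.
elim: k A => [|k IHk] A kA.
  move: kA; rewrite card_cliques1 => /cards0_eq ->.
  by exists (fun=> 0); split=> [x|]; rewrite ?inE // /pairs_in !big_set0.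
have [->|[v0 v0A]] := set_0Vmem A.
  by exists (fun=> 0); split=> [x|]; rewrite ?inE // /pairs_in !big_set0.
case: (arg_maxnP (fun x => #|nbrs A x|) v0A) => v vA vmax.
set B := nbrs A v; have BA : B \subset A by apply/subsetP => x; rewrite inE => /andP[].
have [c [cB cle]] := IHk B (cliques_nbrs0 vA kA).
pose c' x := if x \in B then c x else k.
exists c'; split.
  by move=> x xA; rewrite /c'; case: ifP => [/cB /ltnW|//].
rewrite (pairs_in_setD (@adj_sym G) BA) (pairs_in_setD _ BA); last first.
  by move=> x y; rewrite adj_sym eq_sym.
rewrite (@pairs_in_setD (fun x y => c' x != c' y) _ _ _ BA); last first.
  by move=> x y; rewrite eq_sym.
rewrite (@eq_pairs_in (fun x y => adj x y && (c' x == c' y))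
           (fun x y => adj x y && (c x == c y)) B); last first.
  by move=> x y xB yB /=; rewrite /c' xB yB.
rewrite (@eq_pairs_in (fun x y => c' x != c' y) (fun x y => c x != c y) B);
  last by move=> x y xB yB /=; rewrite /c' xB yB.
set D := A :\: B.
have c'D x : x \in D -> c' x = k by rewrite inE /c' => /andP[/negbTE->].
have c'DB x y : x \in D -> y \in B -> (c' x == c' y) = false.
  by move=> xD yB; rewrite c'D // /c' yB gtn_eqF // cB.
rewrite [X in _ + (_ + 2 * X + _) <= _]big1; last first.
  by move=> x xD; apply: big1 => y yB; rewrite c'DB // andbF.
rewrite (@eq_pairs_in (fun x y => adj x y && (c' x == c' y)) (@adj G) D);
  last by move=> x y xD yD /=; rewrite !c'D // eqxx andbT.
have -> : \sum_(x in D) \sum_(y in B) (c' x != c' y) = #|D| * #|B|.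
  rewrite -sum_nat_const; apply: eq_bigr => x xD; rewrite -sum1_card.
  by apply: eq_bigr => y yB; rewrite c'DB.
(* By the choice of [v] every vertex of [D] has degree at most [#|B|]. Twice the degree sum over [D]
   is exactly what the new class adds on the left. *)
have : \sum_(x in D) #|nbrs A x| <= #|D| * #|B|.
  by rewrite -sum_nat_const; apply: leq_sum => x /setDP[xA _]; apply: vmax.
have -> : \sum_(x in D) #|nbrs A x| =
    \sum_(x in D) \sum_(y in B) adj x y + pairs_in (@adj G) D.
  rewrite /pairs_in -big_split; apply: eq_bigr => x _; rewrite card_nbrs.
  by rewrite (big_setID B) /=; move/setIidPr: BA => ->.
move: cle; lia.
Qed.

(** Cauchy-Schwarz: sum [2 f_i f_j <= f_i^2 + f_j^2] over all ordered pairs. *)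
Lemma sumn_sqr_le k (f : 'I_k -> nat) :
  (\sum_i f i) ^ 2 <= k * \sum_i f i ^ 2.
Proof.
suff : 2 * (\sum_i f i) ^ 2 <= 2 * (k * \sum_i f i ^ 2) by lia.
have -> : 2 * (\sum_i f i) ^ 2 = \sum_i \sum_j 2 * (f i * f j).
  rewrite -mulnn big_distrl /= big_distrr /=; apply: eq_bigr => i _.
  by rewrite big_distrr big_distrr.
have -> : 2 * (k * \sum_i f i ^ 2) = \sum_(i < k) \sum_(j < k) (f i ^ 2 + f j ^ 2).
  under [RHS]eq_bigr do rewrite big_split /= sum_nat_const card_ord.
  by rewrite big_split /= sum_nat_const card_ord -big_distrr /= addnn mul2n.
by apply: leq_sum => i _; apply: leq_sum => j _; exact: nat_Cauchy.
Qed.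

(** The monochromatic pairs, diagonal included, number the sum of the squared class sizes, which is
    at least [#|A| ^ 2 / k]. *)
Lemma pairs_in_neq_le k (c : G -> nat) A : {in A, forall x, c x < k} ->
  k * pairs_in (fun x y => c x != c y) A <= k.-1 * #|A| ^ 2.
Proof.
case: k => [|k] cA; first by rewrite mul0n.
pose f (i : 'I_k.+1) := \sum_(x in A) (c x == i).
have sumf : \sum_i f i = #|A|.
  rewrite exchange_big -sum1_card; apply: eq_bigr => x xA.
  rewrite (bigD1 (Ordinal (cA x xA))) //= eqxx big1 ?addn0 // => i.
  by rewrite -val_eqE /= eq_sym => /negbTE->.
have sumf2 : \sum_i f i ^ 2 = pairs_in (fun x y => c x == c y) A.
  transitivity (\sum_(i < k.+1) \sum_(x in A) \sum_(y in A) (c x == i) * (c y == i)).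
    apply: eq_bigr => i _; rewrite -mulnn big_distrl; apply: eq_bigr => x _.
    by rewrite big_distrr.
  rewrite exchange_big; apply: eq_bigr => x xA.
  rewrite exchange_big; apply: eq_bigr => y yA.
  rewrite (bigD1 (Ordinal (cA x xA))) //= eqxx mul1n big1 ?addn0 1?eq_sym // => i.
  by rewrite -val_eqE /= eq_sym => /negbTE->.
have : pairs_in (fun x y => c x == c y) A + pairs_in (fun x y => c x != c y) A
       = #|A| ^ 2.
  rewrite /pairs_in -big_split -mulnn -sum_nat_const; apply: eq_bigr => x _ /=.
  rewrite -big_split -sum1_card; apply: eq_bigr => y _.
  by case: (c x == c y).
have := sumn_sqr_le f; rewrite sumf sumf2 /=; nia.
Qed.

Lemma pairs_in_adj A : pairs_in (@adj G) A = 2 * #|cliques 2 A|.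
Proof. by rewrite -sum_degrees; apply: eq_bigr => x _; rewrite card_nbrs. Qed.

(** Füredi's colouring has [k.+1] classes and at least as many bichromatic pairs as adjacent
    ones. *)
Lemma turan k A : #|cliques k.+2 A| = 0 ->
  k.+1 * (2 * #|cliques 2 A|) <= k * #|A| ^ 2.
Proof.
move=> kA; have [c [cA cle]] := furedi_colouring kA.
have := pairs_in_neq_le cA; rewrite -pairs_in_adj /=; nia.
Qed.

(** * Moon-Moser inequalities and stability *)

(* A vertex that is not adjacent to all of a clique [S] has at most [#|S| - 1]
   neighbours in it. *)
Lemma sum_degrees_cliques s A :
  \sum_(S in cliques s.+1 A) \sum_(v in S) #|nbrs A v|
    <= s * #|A| * #|cliques s.+1 A| + s.+2 * #|cliques s.+2 A|.
Proof.
(* Both sides count pairs of a clique [S] and a vertex adjacent to all of it. *)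
have -> : s.+2 * #|cliques s.+2 A| =
    \sum_(S in cliques s.+1 A) \sum_(u in A) (S \subset nbrs A u).
  rewrite -card_cliquesS exchange_big /=; apply: eq_bigr => u uA.
  rewrite -sum1_card big_mkcond [RHS]big_mkcond; apply: eq_bigr => S _.
  rewrite !inE; case SN: (S \subset nbrs A u) => /=; last by case: ifP.
  have -> : S \subset A by apply: subset_trans SN _; apply/subsetP => x; rewrite inE => /andP[].
  by case: (_ && _).
rewrite mulnC -sum_nat_const -big_split; apply: leq_sum => S /=.
rewrite inE => /and3P[/subsetP SA /eqP cS kS].
rewrite mulnC -sum_nat_const -big_split /=.
under eq_bigr do rewrite card_nbrs.
rewrite exchange_big; apply: leq_sum => u uA.
have -> : \sum_(v in S) adj v u = #|S :&: nbrs A u|.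
  rewrite -sum1_card big_mkcond [RHS]big_mkcond; apply: eq_bigr => v _.
  rewrite inE mem_nbrs adj_sym; case: (boolP (v \in S)) => //= /SA ->.
  by case: (adj _ _).
case: (boolP (S \subset nbrs A u)) => [/setIidPl ->|nS]; first by rewrite cS addn1.
rewrite addn0 -ltnS -cS; apply: proper_card; rewrite properEneq subsetIl andbT.
by apply: contra nS => /eqP/setIidPl.
Qed.

(* With [k = j + l + 1] and [s = j + 2] this reads
   [k * s * N_s <= (k - s + 1) * #|A| * N_(s-1)] for a K_(k+1)-free graph. *)
Lemma moon_moser j l A : #|cliques (j + l).+2 A| = 0 ->
  (j + l).+1 * (j.+2 * #|cliques j.+2 A|) <= l * (#|A| * #|cliques j.+1 A|).
Proof.
elim: j A => [|j IHj] A kA; first by rewrite card_cliques1 mulnn; exact: turan.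
(* The induction hypothesis is applied inside each neighbourhood, where the forbidden clique is one
   smaller, and summed over the vertices. *)
have : (j + l).+1 * (j.+2 * (j.+3 * #|cliques j.+3 A|)) <=
    l * (j.+1 * #|A| * #|cliques j.+2 A| + j.+3 * #|cliques j.+3 A|).
  apply: leq_trans (leq_mul (leqnn l) (sum_degrees_cliques j.+1 A)).
  rewrite -sum_cliques_nbrs -card_cliquesS !big_distrr /=.
  by apply: leq_sum => v vA; apply: IHj; apply: cliques_nbrs0 kA.
rewrite addSn; move: #|A| #|cliques j.+2 A| #|cliques j.+3 A| => a x y H.
rewrite -(leq_pmul2l (ltn0Sn j)); move: H.
(* The last term cancels against the right side and leaves [j.+1] times the claim. *)
have -> : (j + l).+1 * (j.+2 * (j.+3 * y)) =
    j.+1 * ((j + l).+2 * (j.+3 * y)) + l * (j.+3 * y) by lia.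
lia.
Qed.

(* The product of [moon_moser] over the sizes [3, ..., j + 2]. *)
Lemma cliques_le_edges j l A : #|cliques (j + l).+3 A| = 0 ->
  (j + l).+2 ^ j * (j.+2`! * (l`! * #|cliques j.+2 A|))
    <= #|A| ^ j * ((j + l)`! * (2 * #|cliques 2 A|)).
Proof.
elim: j l => [|j IHj] l kA.
  by rewrite !expn0 !mul1n add0n (_ : 2`! = 2) //; lia.
have := IHj l.+1; rewrite addnS -addSn => /(_ kA) H2.
have := @moon_moser j.+1 l.+1 A; rewrite addnS => /(_ kA) H1.
rewrite (factS j.+2) !expnS; move: H2; rewrite (factS l) => H2.
move: (#|cliques 2 A|) (#|cliques j.+2 A|) (#|cliques j.+3 A|) H1 H2 => E x y.
move: ((j.+1 + l).+2) ((j.+1 + l)`!) (j.+2`!) (l`!) #|A| => k f f2 fl a H1 H2.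
have H3 := leq_mul (leqnn a) H2.
have H4 := leq_mul (leqnn (k ^ j * f2 * fl)) H1.
move: (k ^ j) (a ^ j) H3 H4 => kj aj; lia.
Qed.

(** Let [a = #|A|], let [M] count the monochromatic adjacent pairs and [e] the edges, and put
    [x = N_k / (a/k)^k]. The colouring gives [2e + M <= (1 - 1/k) a^2], Moon-Moser gives
    [2e >= x (1 - 1/k) a^2]. Hence [M <= (1 - x) a^2], stated here without division. *)
Lemma cliques_stability k A : 0 < k -> #|cliques k.+1 A| = 0 ->
  exists c : G -> nat, {in A, forall x, c x < k} /\
    pairs_in (fun x y => adj x y && (c x == c y)) A * #|A| ^ k
      + #|A| ^ 2 * (k ^ k * #|cliques k A|) <= #|A| ^ 2 * #|A| ^ k.
Proof.
move=> k0 kA; have [c [cA cle]] := furedi_colouring kA; exists c; split=> //.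
have hle := pairs_in_neq_le cA; move: cle hle; rewrite pairs_in_adj.
case: k k0 kA {cA} => [//|[|k]] _ kA /=.
  by rewrite card_cliques1 expn1 exp1n; nia.
have := @cliques_le_edges k 0 A; rewrite addn0 => /(_ kA).
rewrite fact0 mul1n 2!factS !expnS expn0.
move: (k`!) (fact_gt0 k) => f f0.
move: (#|cliques 2 A|) (#|cliques k.+2 A|) #|A| (pairs_in _ A) (pairs_in _ A).
move: (k.+2 ^ k) => K E x a H M; move: (a ^ k) => ak Hx Mle Hle.
have {}Hx : K * (k.+2 * (k.+1 * x)) <= ak * (2 * E).
  by rewrite -(leq_pmul2r f0); move: Hx; lia.
have L1 := leq_mul (leqnn (k.+2 * ak)) Mle.
have L2 := leq_mul (leqnn ak) Hle.
have L3 := leq_mul (leqnn k.+2) Hx.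
have L4 : k.+2 * (M * ak) + k.+1 * (k.+2 * (k.+2 * (K * x))) <= k.+1 * (a * a * ak).
  by lia.
(* This is [N_k <= (a/k)^k]; it allows the factor [1 - 1/k] in [L4] to be dropped. *)
have x1 : k.+2 * (k.+2 * (K * x)) <= a * a * ak by nia.
have M1 : M * ak + k.+2 * (k.+2 * (K * x)) <= a * a * ak by nia.
have := leq_mul (leqnn (a * a)) M1; lia.
Qed.

End CliqueCounts.

(** * Intersecting families of sets *)

Section IntersectingFamilies.
Variable V : finType.
Implicit Types (S T U W : {set V}).

Lemma subset_of_card j S : j <= #|S| -> exists2 W : {set V}, W \subset S & #|W| = j.
Proof.
move=> jS; exists [set x in take j (enum S)].
  by apply/subsetP => x; rewrite inE => /mem_take; rewrite mem_enum.
rewrite cardsE (card_uniqP _) ?take_uniq ?enum_uniq // size_takel //.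
by rewrite -cardE.
Qed.

Lemma card_supersets W r : #|[set S : {set V} | (W \subset S) && (#|S| == r)]|
  <= #|V| ^ (r - #|W|).
Proof.
apply: leq_trans (_ : #|[set Q : {set V} | #|Q| == r - #|W|]| <= _); last first.
  rewrite card_draws; apply: leq_trans (leq_pmulr _ (fact_gt0 (r - #|W|))) _.
  rewrite bin_ffact ffact_prod -[X in _ ^ X]card_ord -prod_nat_const.
  by apply: leq_prod => i _; apply: leq_subr.
rewrite -(@card_in_imset _ _ (fun S => S :\: W)).
  apply: subset_leq_card; apply/subsetP => _ /imsetP[S /[!inE] /andP[WS /eqP <-] ->].
  by rewrite cardsD (setIidPr WS).
move=> S S' /[!inE] /andP[WS _] /andP[WS' _] eqD.
by rewrite -(setID S W) -[RHS](setID S' W) eqD (setIidPr WS) (setIidPr WS').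
Qed.

(** Each such set contains one of the at most [2 ^ #|U|] subsets of [U] of size [j]. *)
Lemma card_meeting U r j :
  #|[set S : {set V} | (#|S| == r) && (j <= #|S :&: U|)]| <= 2 ^ #|U| * #|V| ^ (r - j).
Proof.
pose P := [set W in powerset U | #|W| == j].
apply: leq_trans
  (_ : #|\bigcup_(W in P) [set S : {set V} | (W \subset S) && (#|S| == r)]| <= _).
  apply: subset_leq_card; apply/subsetP => S /[!inE] /andP[Sr].
  case/subset_of_card => W WSU Wj; apply/bigcupP; exists W.
    by rewrite inE powersetE Wj eqxx andbT (subset_trans WSU) ?subsetIr.
  by rewrite inE Sr (subset_trans WSU) ?subsetIl.
apply: (@leq_trans (\sum_(W in P) #|[set S : {set V} | (W \subset S) && (#|S| == r)]|)).
  elim/big_ind2: _ => [|A a B b Aa Bb|//]; first by rewrite cards0.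
  by rewrite (leq_trans (leq_card_setU _ _)) // leq_add.
rewrite -card_powerset.
apply: (@leq_trans (\sum_(W in P) #|V| ^ (r - j))).
  by apply: leq_sum => W /[!inE] /andP[_ /eqP <-]; apply: card_supersets.
rewrite sum_nat_const leq_mul2r subset_leq_card ?orbT //.
by apply/subsetP => W /[!inE] /andP[].
Qed.

(* If two members meet in exactly [t] points [T] and a third one misses part of
   [T], then all members meet the union of the three in more than [t] points;
   if no two members meet in exactly [t] points, one member serves as well. *)
Lemma intersecting_dichotomy (F : {set {set V}}) r t : 
  {in F, forall S, #|S| = r} -> {in F &, forall S S', t <= #|S :&: S'|} ->
  (exists2 T : {set V}, #|T| = t & {in F, forall S, T \subset S}) \/
  #|F| <= 8 ^ r * #|V| ^ (r - t.+1).
Proof.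
move=> Fr Ft.
have bound U : #|U| <= 3 * r -> {in F, forall S, t < #|S :&: U|} ->
    #|F| <= 8 ^ r * #|V| ^ (r - t.+1).
  move=> cU FU; apply: leq_trans (leq_trans (card_meeting U r t.+1) _).
    apply: subset_leq_card; apply/subsetP => S SF.
    by rewrite inE Fr // eqxx FU.
  by rewrite leq_mul2r -[8]/(2 ^ 3) -expnM leq_pexp2l ?orbT.
have [/exists_inP[S1 S1F /exists_inP[S2 S2F /eqP S12]]|noT] :=
    boolP [exists S1 in F, exists S2 in F, #|S1 :&: S2| == t]; last first.
  right; have [->|[S1 S1F]] := set_0Vmem F; first by rewrite cards0.
  apply: (bound S1); first by rewrite Fr // leq_pmull.
  move=> S SF; rewrite ltn_neqAle Ft // andbT eq_sym.
  apply: contra noT => SS1; apply/exists_inP; exists S => //.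
  by apply/exists_inP; exists S1.
have [/forall_inP allT|] := boolP [forall S in F, S1 :&: S2 \subset S].
  by left; exists (S1 :&: S2).
rewrite negb_forall_in => /exists_inP[S3 S3F nS3]; right.
apply: (bound (S1 :|: S2 :|: S3)).
  by rewrite !cardsU (Fr S1) // (Fr S2) // (Fr S3) //; lia.
move=> S SF; rewrite ltnNge; apply: contra nS3 => SU.
(* If [S] meets the union in at most [t] elements, its traces on the three sets all equal its trace
   on the union. They lie in [S1 :&: S2] and have at least [t] elements, so they equal it, which
   puts [S1 :&: S2] inside [S3]. *)
have SI S' : S' \in F -> S' \subset S1 :|: S2 :|: S3 ->
    S :&: S' = S :&: (S1 :|: S2 :|: S3).
  move=> S'F S'U; apply/eqP; rewrite eqEcard setIS //=.
  exact: leq_trans SU (Ft _ _ SF S'F).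
have S1U : S1 \subset S1 :|: S2 :|: S3 by rewrite -setUA subsetUl.
have S2U : S2 \subset S1 :|: S2 :|: S3 by rewrite setUAC subsetUr.
have S3U : S3 \subset S1 :|: S2 :|: S3 by rewrite subsetUr.
have <- : S :&: S3 = S1 :&: S2; last exact: subsetIr.
apply/eqP; rewrite eqEcard S12 Ft // andbT subsetI.
by rewrite {1}(SI S3) // -(SI S1) // subsetIr (SI S3) // -(SI S2) // subsetIr.
Qed.

End IntersectingFamilies.

(** * Copies of [K_r] and their common kernel *)

Lemma copiesE r (G : sgraph) : copies r G = cliques r [set: G].
Proof.
apply/setP => S; rewrite !inE subsetT /=; case: eqP => //= cS.
apply/asboolP/cliqueP => [[f fbij fadj] x y xS yS xy|kS].
  have := fadj (exist _ x xS) (exist _ y yS).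
  rewrite /= /induced_adj /complete_adj /= => <-.
  by rewrite (bij_eq fbij) -val_eqE.
have cE : #|{: {x : G | x \in S}}| = r by rewrite card_sig -cS; apply: eq_card.
(* Adjacency in [complete r] is mere inequality, so on a clique any bijection will do. *)
exists (fun x : induced S => cast_ord cE (enum_rank x) : complete r).
  apply: inj_card_bij; last by rewrite card_ord cE.
  by move=> x y /cast_ord_inj /enum_rank_inj.
move=> x y; rewrite /= /induced_adj /complete_adj.
rewrite (inj_eq (@cast_ord_inj _ _ _)) (inj_eq enum_rank_inj) -val_eqE /=.
case: eqVneq => [->|xy]; first by rewrite adj_irrefl.
by rewrite kS ?(valP x) ?(valP y).
Qed.

Definition common_nbrs (G : sgraph) (T : {set G}) := [set y | [forall x in T, adj x y]].

Section Kernel.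
Variables (G : sgraph) (r : nat) (T : {set G}).
Hypothesis Tsub : {in cliques r [set: G], forall S : {set G}, T \subset S}.

Lemma common_nbrs_sub : common_nbrs T \subset ~: T.
Proof.
apply/subsetP => y; rewrite !inE => /forall_inP yT.
by apply/negP => /yT; rewrite adj_irrefl.
Qed.

(** Removing [T] is injective, as all these cliques contain [T], and what remains of a clique is
    adjacent to all of [T]. *)
Lemma cliques_common_nbrs :
  #|cliques r [set: G]| <= #|cliques (r - #|T|) (common_nbrs T)|.
Proof.
rewrite -(@card_in_imset _ _ (fun S => S :\: T)); last first.
  move=> S S' /Tsub TS /Tsub TS' eqD.
  by rewrite -(setID S T) -[RHS](setID S' T) eqD (setIidPr TS) (setIidPr TS').
apply: subset_leq_card; apply/subsetP => _ /imsetP[S SF ->].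
have TS := Tsub SF; move: SF; rewrite !inE => /and3P[_ /eqP <- kS].
rewrite cardsD (setIidPr TS) eqxx (sub_clique (subsetDl S T) kS) !andbT.
apply/subsetP => y /setDP[yS yT]; rewrite inE; apply/forall_inP => x xT.
move/cliqueP: kS => -> //; first exact: (subsetP TS).
by apply: contraNneq yT => <-.
Qed.

(* Otherwise replacing a vertex of [T] by a clique of size [r - t + 1] of its
   common neighbourhood gives a clique of size [r] avoiding that vertex. *)
Lemma common_nbrs_free : 0 < #|T| <= r -> 0 < #|cliques r [set: G]| ->
  #|cliques (r - #|T|).+1 (common_nbrs T)| = 0.
Proof.
move=> /andP[/card_gt0P[x xT] Tr] /card_gt0P[S0 S0F].
have kT : clique T.
  by apply: sub_clique (Tsub S0F) _; move: S0F; rewrite inE => /and3P[].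
apply/eqP; rewrite cards_eq0; apply/set0Pn => -[Q]; rewrite inE => /and3P[QA /eqP cQ kQ].
have QT y : y \in Q -> y \notin T.
  by move/(subsetP QA)/(subsetP common_nbrs_sub); rewrite inE.
have adjTQ y z : y \in T -> z \in Q -> adj y z.
  by move=> yT /(subsetP QA); rewrite inE => /forall_inP; apply.
have dTQ : (T :\ x) :&: Q = set0.
  apply/setP => y; rewrite !inE; case: (boolP (y \in Q)); rewrite ?andbF //.
  by move/QT/negbTE->; rewrite andbF.
have /Tsub/subsetP/(_ x xT) : (T :\ x) :|: Q \in cliques r [set: G].
  rewrite inE subsetT cardsU dTQ cards0 subn0 cQ /=; apply/andP; split.
    by move: Tr; have := cardsD1 x T; rewrite xT; lia.
  apply/cliqueP => y z /setUP[/setD1P[_ yT]|yQ] /setUP[/setD1P[_ zT]|zQ] yz.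
  - by move/cliqueP: kT; apply.
  - exact: adjTQ.
  - by rewrite adj_sym adjTQ.
  - by move/cliqueP: kQ; apply.
by rewrite !inE eqxx /= => /QT; rewrite xT.
Qed.

End Kernel.

(** * From the colouring to the deleted edges *)

Lemma card_pairs_in (G : sgraph) (w : rel G) (A : {set G}) :
  #|[set q : G * G | [&& q.1 \in A, q.2 \in A & w q.1 q.2]]| = pairs_in w A.
Proof.
rewrite /pairs_in pair_big -sum1_card big_mkcond [RHS]big_mkcond.
apply: eq_bigr => -[x y] _; rewrite inE /=.
by case: (x \in A); case: (y \in A); case: (w x y).
Qed.

Lemma partite_after_deletion k (G : sgraph) (T A : {set G}) (c : G -> nat) :
  0 < k -> A \subset ~: T -> {in A, forall x, c x < k} ->
  exists F : {set {set delete_vertices T}},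
    [/\ F \subset edges (delete_vertices T),
        #|F| <= pairs_in (fun x y => adj x y && (c x == c y)) A
                + (#|~: T| - #|A|) * #|~: T|
      & partite k (delete_edges F)].
Proof.
(* Vertices outside [A] get an arbitrary colour; reduction modulo [k] keeps the colours on [A]. *)
move=> k0 AT cA; pose c' (x : delete_vertices T) := Ordinal (ltn_pmod (c (val x)) k0).
(* A pair starting in [A] must end in [A], so an edge with just one end outside [A] is listed only
   from that end. *)
pose P := [set p : delete_vertices T * delete_vertices T |
  [&& adj p.1 p.2, c' p.1 == c' p.2 & (val p.1 \in A) ==> (val p.2 \in A)]].
exists [set [set p.1; p.2] | p in P]; split.
- apply/subsetP => _ /imsetP[p /[!inE] /and3P[adjp _ _] ->].
  by apply/imsetP; exists p; rewrite ?inE.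
- apply: leq_trans (leq_imset_card _ _) _.
  rewrite -(@card_imset _ _ (fun p : delete_vertices T * delete_vertices T =>
     (val p.1, val p.2))); last by move=> [x y] [x' y'] /= [/val_inj -> /val_inj ->].
  rewrite -{2}(setIidPr AT) -card_pairs_in -cardsD -cardsX.
  apply: leq_trans (leq_card_setU _ _); apply: subset_leq_card.
  apply/subsetP => _ /imsetP[[x y] /[!inE] /= /and3P[adjxy cxy xAy] ->] /=.
  move: (valP x) (valP y) adjxy cxy xAy; rewrite /= /induced_adj !inE => -> ->.
  rewrite -val_eqE /=; move: (val x) (val y) => {x y} x y -> /=.
  case: (boolP (x \in A)) => //= xA cxy yA; rewrite yA /=.
  by rewrite -(modn_small (cA x xA)) -(modn_small (cA y yA)) cxy.
- exists c' => i x y; rewrite !inE => /eqP cx /eqP cy.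
  apply/negP => /andP[adjxy /negP]; apply.
  have [yA|yA] := boolP (val y \in A).
    by apply/imsetP; exists (x, y); rewrite // inE; apply/and3P; split; rewrite ?cx ?cy ?yA ?implybT.
  apply/imsetP; exists (y, x); last exact: setUC.
  have adjyx : @adj (delete_vertices T) y x by rewrite adj_sym.
  by rewrite inE; apply/and3P; split; rewrite ?cx ?cy ?(negbTE yA).
Qed.

(** * Numerical bounds and conclusion *)

Import Order.TTheory GRing.Theory Num.Theory.
Local Open Scope ring_scope.

(** Put [nu = k^k N]. The stability inequality with [nu >= (1 - eps) a^k] gives [mono <= eps a^2].
    It also gives [nu <= a^k], so [(1 - eps) m^k <= a m^(k-1)] and [m - a <= eps m]. Each of the two
    terms is thus at most [eps m^2]. *)
Lemma deleted_edges_bound (R : realType) (eps : R) (k a m mono N : nat) :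
  (0 < k)%N -> (0 < a <= m)%N -> eps < 1 ->
  (1 - eps) * m%:R ^+ k <= (k ^ k * N)%:R ->
  (mono * a ^ k + a ^ 2 * (k ^ k * N) <= a ^ 2 * a ^ k)%N ->
  (mono + (m - a) * m)%:R <= 2 * eps * m%:R ^+ 2.
Proof.
move=> k0 /andP[a0 am] eps1; move: (k ^ k * N)%N => nu lower upper.
have a0R : 0 < a%:R :> R by rewrite ltr0n.
have amR : a%:R <= m%:R :> R by rewrite ler_nat.
have m0R : 0 < m%:R :> R := lt_le_trans a0R amR.
have amk : a%:R ^+ k <= m%:R ^+ k :> R by rewrite lerXn2r ?nnegrE ?ler0n.
have ak0 : 0 < a%:R ^+ k :> R by rewrite exprn_gt0.
have mono0 : 0 <= mono%:R :> R by rewrite ler0n.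
move: upper; rewrite -(ler_nat R) natrD !natrM !natrX => upper.
have mono_le : mono%:R <= eps * a%:R ^+ 2.
  rewrite -(ler_pM2r ak0); have a20 : 0 <= a%:R ^+ 2 :> R by rewrite sqr_ge0.
  have := ler_wpM2l a20 lower.
  have : (1 - eps) * a%:R ^+ k <= (1 - eps) * m%:R ^+ k by rewrite ler_pM2l ?subr_gt0.
  move=> /(ler_wpM2l a20); lra.
(* A negative [eps] is excluded by [0 <= mono <= eps a^2]. *)
have eps0 : 0 <= eps.
  by rewrite -(pmulr_lge0 _ (exprn_gt0 2 a0R)) (le_trans mono0).
have a_ge : (1 - eps) * m%:R <= a%:R.
  have nu_le : nu%:R <= a%:R ^+ k :> R.
    rewrite -(ler_pM2l (exprn_gt0 2 a0R)); apply: le_trans upper.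
    by rewrite lerDr mulr_ge0 // ltW.
  case: k k0 {upper amk ak0 mono_le} lower nu_le => // k _ lower nu_le.
  rewrite -(ler_pM2r (exprn_gt0 k m0R)) -mulrA -exprS.
  apply: le_trans (le_trans lower nu_le) _.
  by rewrite exprS ler_pM2l // lerXn2r ?nnegrE ?ler0n.
rewrite natrD natrM natrB //.
have := ler_wpM2r (ltW m0R) a_ge.
have : eps * a%:R ^+ 2 <= eps * m%:R ^+ 2.
  by rewrite ler_wpM2l // lerXn2r ?nnegrE ?ler0n.
rewrite !expr2; lra.
Qed.

Theorem theorem1p4 (R : realType) (r t : nat) (ht : (1 <= t)%N) (htr : (t < r)%N) :
  exists (eps0 : R) (n0 : nat), 0 < eps0 /\
    forall (eps : R) (n : nat) (G : sgraph),
      eps < eps0 -> (n0 <= n)%N -> #|G| = n -> intersecting r t G ->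
      (1 - eps) * ((n%:R - t%:R) / (r%:R - t%:R)) ^+ (r - t)
        <= #|copies r G|%:R ->
      exists T : {set G}, #|T| = t /\
        exists F : {set {set delete_vertices T}},
          [/\ F \subset edges (delete_vertices T),
              #|F|%:R <= 2 * eps * (n%:R - t%:R) ^+ 2
            & partite (r - t) (delete_edges F)].
Proof.
set k := (r - t)%N; have k0 : (0 < k)%N by rewrite subn_gt0.
(* The bound [1 / 2] yields [many]. The summand [2 * t] ensures [n <= 2 * m], and the rest makes [m]
   too large for the second case of the dichotomy. *)
exists (1 / 2), (2 * t + 2 ^ k * k ^ k * 8 ^ r + 1)%N; split; first lra.
move=> eps n G eps_lt n_ge cardG inter.
rewrite -(natrB R (ltnW htr)) -/k -natrB; last by lia.
set m := (n - t)%N => lower.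
have lowerk : (1 - eps) * m%:R ^+ k <= (k ^ k * #|copies r G|)%:R.
  have kk0 : 0 < k%:R ^+ k :> R by rewrite exprn_gt0 ?ltr0n.
  rewrite natrM natrX -(divfK (lt0r_neq0 kk0) (m%:R ^+ k)) -expr_div_n.
  by rewrite mulrA mulrC ler_pM2l.
have m0 : (0 < m)%N by rewrite /m; lia.
have many : (m ^ k <= 2 * (k ^ k * #|copies r G|))%N.
  rewrite -(ler_nat R) natrM natrX.
  have : 0 <= m%:R ^+ k :> R by rewrite exprn_ge0.
  move: lowerk eps_lt; nra.
have [||[T cT Tsub]|few] := @intersecting_dichotomy G (copies r G) r t.
- by move=> S; rewrite copiesE inE => /and3P[_ /eqP].
- move=> S S' SF S'F; have [<-|] := eqVneq S S'; last by case/inter/andP.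
  by move: SF; rewrite setIid copiesE inE => /and3P[_ /eqP-> _]; apply: ltnW.
- exists T; split => //; move: lowerk many; rewrite copiesE => lowerk many.
  have Tsub' : {in cliques r [set: G], forall S : {set G}, T \subset S}.
    by rewrite -copiesE.
  have pos : (0 < #|cliques r [set: G]|)%N.
    move: many; case: #|_| => //; rewrite !muln0 leqn0 expn_eq0 => /andP[/eqP].
    by move: m0 => /[swap] ->.
  have Tr : (0 < #|T| <= r)%N by rewrite cT ht ltnW.
  have free := common_nbrs_free Tsub' Tr pos.
  have le_cliques := cliques_common_nbrs Tsub'.
  have AT := common_nbrs_sub T; move: free le_cliques AT.
  rewrite cT -/k; move: (common_nbrs T) => A free le_cliques AT.
  have [c [cA stab]] := cliques_stability k0 free.
  have [F [Fedges cF Fpart]] := partite_after_deletion k0 AT cA.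
  exists F; split=> //.
  have cTc : #|~: T| = m by rewrite cardsCs setCK cT cardG.
  rewrite cTc in cF.
  apply: le_trans (_ : (_ : nat)%:R <= _); first by rewrite ler_nat; apply: cF.
  apply: deleted_edges_bound stab => //.
  + rewrite -cTc (subset_leq_card AT) andbT; apply: leq_trans k0 _.
    have /card_gt0P[S] := leq_trans pos le_cliques.
    by rewrite inE => /and3P[SA /eqP <- _]; apply: subset_leq_card.
  + lra.
  + by apply: le_trans lowerk _; rewrite ler_nat leq_mul2l le_cliques orbT.
(* Here [m^k <= 2 k^k 8^r n^(k-1) <= 2^k k^k 8^r m^(k-1)], and dividing by [m^(k-1)] contradicts the
   choice of [n0]. *)
- have m_le : (m <= 2 ^ k * k ^ k * 8 ^ r)%N; last by move: n_ge m_le; rewrite /m; lia.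
  have n2m : (n <= 2 * m)%N by move: n_ge; rewrite /m; lia.
  have npow : (n ^ k.-1 <= (2 * m) ^ k.-1)%N.
    by case: k.-1 => // j; rewrite leq_exp2r.
  rewrite -(leq_pmul2r (_ : 0 < m ^ k.-1)%N) ?expn_gt0 ?m0 // -expnS prednK //.
  apply: leq_trans many _; rewrite cardG subnS -/k in few.
  rewrite -[X in (2 ^ X)%N](prednK k0) expnS -!mulnA leq_pmul2l //.
  rewrite [leqRHS]mulnCA leq_mul2l; apply/orP; right.
  apply: leq_trans few _; rewrite [leqRHS]mulnCA leq_mul2l -expnMn npow.
  by rewrite orbT.
Qed.
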